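(* Every finitely generated extension of $\mathrm{BD}_\infty$ with the PCP has a finite Hilbert-style axiomatization (it is axiomatized by finitely many finitary rules).
   Context: Formulas are built from variables using $\wedge,\vee,\neg$. A structure is a pair $\langle\mathbf{A},F\rangle$, $F\subseteq A$; a rule $\Gamma\vdash\varphi$ is valid in it if every homomorphism $v$ from the formula algebra with $v[\Gamma]\subseteq F$ has $v(\varphi)\in F$. A logic is a substitution-invariant consequence relation; a finitely generated logic is one determined by a finite set of finite structures. $\mathrm{BD}_\infty$ is the logic determined by all $\langle\mathbf{A},F\rangle$ with $\mathbf{A}$ a De~Morgan lattice (distributive lattice with $\neg$, $\neg\neg x=x$, De~Morgan laws) and $F$ an upset; an extension of it is a logic containing its consequence relation. $\mathcal{L}$ has the PCP if $\Gamma,\varphi_1\vdash_{\mathcal{L}}\psi$ and $\Gamma,\varphi_2\vdash_{\mathcal{L}}\psi$ imply $\Gamma,\varphi_1\vee\varphi_2\vdash_{\mathcal{L}}\psi$. *)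

(* Defs.v *)
From mathcomp Require Import all_boot all_classical.

Set Implicit Arguments.
Unset Strict Implicit.
Unset Printing Implicit Defensive.

Local Open Scope classical_set_scope.

Record algebra := Algebra {
  carrier :> Type;
  meet : carrier -> carrier -> carrier;
  join : carrier -> carrier -> carrier;
  neg : carrier -> carrier
}.

Definition is_hom (A B : algebra) (h : A -> B) : Prop :=
  [/\ {morph h : x y / meet x y >-> meet x y},
      {morph h : x y / join x y >-> join x y} &
      {morph h : x / neg x >-> neg x}].

Inductive formula : Type :=
| Var of nat
| And of formula & formula
| Or of formula & formula
| Not of formula.

Definition formula_algebra : algebra := Algebra And Or Not.

Definition is_subst (s : formula -> formula) : Prop :=
  @is_hom formula_algebra formula_algebra s.

Record structure := Structure {
  alg :> algebra;
  designated : set alg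
}.

Record rule := Rule {
  premises : set formula;
  conclusion : formula
}.

Definition valid (M : structure) (r : rule) : Prop :=
  forall v : formula -> M, @is_hom formula_algebra M v ->
    v @` premises r `<=` @designated M -> @designated M (v (conclusion r)).

Definition consequence := set formula -> formula -> Prop.

Record is_logic (L : consequence) : Prop := IsLogic {
  logic_refl : forall (G : set formula) f, G f -> L G f;
  logic_mono : forall (G D : set formula) f, G `<=` D -> L G f -> L D f;
  logic_cut : forall (G D : set formula) f,
    (forall d, D d -> L G d) -> L D f -> L G f;
  logic_subst : forall s, is_subst s -> forall (G : set formula) f,
    L G f -> L (s @` G) (s f)
}.

Definition logic_of (K : set structure) : consequence :=
  fun G f => forall M, K M -> valid M (Rule G f).

Definition determined_by (L : consequence) (K : set structure) : Prop :=
  forall G f, L G f <-> logic_of K G f.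

Definition finite_structure (M : structure) : Prop := finite_set [set: M].

Definition finitely_generated (L : consequence) : Prop :=
  exists K : set structure,
    [/\ finite_set K, K `<=` finite_structure & determined_by L K].

(* The first seven fields are the axioms of Order.isMeetJoinDistrLattice, in
   equational form, so that no decidable equality or choice operator on the
   carrier is required. *)
Record is_deMorgan_lattice (A : algebra) : Prop := IsDeMorganLattice {
  dm_meetC : commutative (@meet A);
  dm_joinC : commutative (@join A);
  dm_meetA : associative (@meet A);
  dm_joinA : associative (@join A);
  dm_joinKI : forall x y : A, meet x (join x y) = x;
  dm_meetKU : forall x y : A, join x (meet x y) = x;
  dm_meetUl : left_distributive (@meet A) (@join A);
  dm_negK : involutive (@neg A);
  dm_negI : {morph @neg A : x y / meet x y >-> join x y};
  dm_negU : {morph @neg A : x y / join x y >-> meet x y}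
}.

Definition lat_le (A : algebra) (x y : A) : Prop := meet x y = x.

Definition is_upset (A : algebra) (F : set A) : Prop :=
  forall x y, lat_le x y -> F x -> F y.

Definition BDinfty : consequence :=
  logic_of [set M : structure | is_deMorgan_lattice M /\ is_upset (@designated M)].

Definition extends (L L0 : consequence) : Prop :=
  forall G f, L0 G f -> L G f.

Definition PCP (L : consequence) : Prop :=
  forall (G : set formula) f1 f2 g,
    L (G `|` [set f1]) g -> L (G `|` [set f2]) g ->
    L (G `|` [set Or f1 f2]) g.

Definition finitary (r : rule) : Prop := finite_set (premises r).

(* Hilbert-style derivability: closure of the assumptions G under all
   substitution instances of the rules in R (axioms are rules without
   premises). *)
Inductive derivable (R : set rule) (G : set formula) : formula -> Prop :=
| derivable_hyp f : G f -> derivable R G f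
| derivable_rule r s : R r -> is_subst s ->
    (forall p, premises r p -> derivable R G (s p)) ->
    derivable R G (s (conclusion r)).

Definition axiomatized_by (L : consequence) (R : set rule) : Prop :=
  forall G f, L G f <-> derivable R G f.

Definition has_finite_Hilbert_axiomatization (L : consequence) : Prop :=
  exists R : set rule,
    [/\ finite_set R, R `<=` finitary & axiomatized_by L R].

(* Main.v *)
(** A Baker-style finite basis argument.  If all generating structures have at
    most [N + 1] elements, no [N + 2] elements of a prime [L]-theory are pairwise
    separated by its Leibniz congruence.  For prime theories over De Morgan
    lattices this congruence is tested by the contexts [x /\ c] and [~ x /\ c],
    so the bound is a finite set of rules
    "separating literals |- disjunction of the opposite literals".  A prime theory
    satisfying them has a quotient with at most [N + 1] elements, and whether such
    a quotient is a model of [L] is decided by the [L]-rules between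
    representatives of the finitely many classes of formulas in [N + 1] variables.
    Adding to every rule [G |- f] its companion [G \/ p |- f \/ p], valid in [L]
    by the PCP, gives the Hilbert system the PCP, hence enough prime theories. *)

From HB Require Import structures.
From mathcomp Require Import all_boot all_classical.
Require Import Defs.

Set Implicit Arguments.
Unset Strict Implicit.
Unset Printing Implicit Defensive.

Local Open Scope classical_set_scope.

(** * Formulas, evaluations and substitutions *)

HB.instance Definition _ := gen_eqMixin formula.
HB.instance Definition _ := gen_choiceMixin formula.

Fixpoint ext (A : algebra) (v : nat -> A) (f : formula) : A :=
  match f with
  | Var n => v n
  | And f g => meet (ext v f) (ext v g)
  | Or f g => join (ext v f) (ext v g)
  | Not f => neg (ext v f)
  end.

Definition subst : (nat -> formula) -> formula -> formula :=
  @ext formula_algebra.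

Lemma ext_is_hom (A : algebra) (v : nat -> A) :
  @is_hom formula_algebra A (ext v).
Proof. by split. Qed.

Lemma hom_ext (A : algebra) (h : formula -> A) :
  @is_hom formula_algebra A h -> h =1 ext (fun n => h (Var n)).
Proof.
move=> [hI hU hN]; elim=> //= [f IHf g IHg|f IHf g IHg|f IHf].
- by rewrite -IHf -IHg; exact: hI.
- by rewrite -IHf -IHg; exact: hU.
- by rewrite -IHf; exact: hN.
Qed.

Lemma eq_ext (A : algebra) (v w : nat -> A) : v =1 w -> ext v =1 ext w.
Proof. by move=> /funext ->. Qed.

Lemma ext_subst (A : algebra) (v : nat -> A) (s : nat -> formula) f :
  ext v (subst s f) = ext (fun n => ext v (s n)) f.
Proof. by elim: f => //= [f -> g ->|f -> g ->|f ->]. Qed.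

Lemma subst_subst (t s : nat -> formula) f :
  subst t (subst s f) = subst (fun n => subst t (s n)) f.
Proof. exact: (@ext_subst formula_algebra). Qed.

(** * Derivability and prime theories *)

Section Derivability.
Variable R : set rule.

Lemma derivable_mono (G D : set formula) f :
  G `<=` D -> derivable R G f -> derivable R D f.
Proof.
move=> GD; elim=> [g /GD|r s Rr hs _ IH]; first exact: derivable_hyp.
exact: derivable_rule.
Qed.

Lemma derivable_cut (G D : set formula) f :
  (forall d, D d -> derivable R G d) -> derivable R D f -> derivable R G f.
Proof.
by move=> GD; elim=> [g /GD//|r s Rr hs _ IH]; exact: derivable_rule.
Qed.

Lemma derivable_cut1 (G : set formula) f g :
  derivable R G f -> derivable R (G `|` [set f]) g -> derivable R G g.
Proof.
move=> Gf; apply: derivable_cut => d [Gd|-> //]; exact: derivable_hyp.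
Qed.

Lemma derivable_subst_rule (G : set formula) r s :
  R r -> (forall p, premises r p -> derivable R G (subst s p)) ->
  derivable R G (subst s (conclusion r)).
Proof. by move=> Rr; apply: derivable_rule => //; exact: ext_is_hom. Qed.

Lemma derivable_sound (L : consequence) : is_logic L ->
  (forall r, R r -> L (premises r) (conclusion r)) ->
  forall G f, derivable R G f -> L G f.
Proof.
move=> Llog RL G f; elim=> [g|r s Rr hs _ IH]; first exact: logic_refl.
apply: (logic_cut Llog) (logic_subst Llog hs (RL _ Rr)).
by move=> _ [p rp <-]; exact: IH.
Qed.

Hypothesis Rfin : R `<=` finitary.

(** A rule has finitely many premises, so the members of the chain from which they are derived have
    a largest one. *)
Lemma derivable_chain (G : set formula) (F : set (set formula)) f :
  F !=set0 -> total_on F subset -> derivable R (G `|` \bigcup_(X in F) X) f ->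
  exists2 X, F X & derivable R (G `|` X) f.
Proof.
move=> [X0 FX0] Ftot; elim=> [g [Gg|[X FX Xg]]|r s Rr hs _ IH].
- by exists X0 => //; apply: derivable_hyp; left.
- by exists X => //; apply: derivable_hyp; right.
have /finite_seqP[l rl] := Rfin Rr; rewrite rl /= in IH.
suff [X FX HX] : exists2 X, F X & forall p, p \in l -> derivable R (G `|` X) (s p).
  by exists X => //; apply: derivable_rule => // p; rewrite rl /=; exact: HX.
elim: l IH {rl} => [|p l IHl] Hl; first by exists X0.
have [X FX HX] : exists2 X, F X & forall p, p \in l -> derivable R (G `|` X) (s p).
  by apply: IHl => q ql; apply: Hl; rewrite in_cons ql orbT.
have [Y FY HY] := Hl p (mem_head _ _).
have [XY|YX] := Ftot _ _ FX FY.
- exists Y => // q; rewrite in_cons => /orP[/eqP-> //|/HX].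
  by apply: derivable_mono => h [|/XY]; [left|right].
- exists X => // q; rewrite in_cons => /orP[/eqP->|/HX//].
  by apply: derivable_mono HY => h [|/YX]; [left|right].
Qed.

(** Lindenbaum's lemma: a maximal set that does not yield [f] is closed under the rules, and the PCP
    makes it prime. *)
Lemma prime_extension (G : set formula) f :
  PCP (derivable R) -> ~ derivable R G f ->
  exists T : set formula,
    [/\ G `<=` T, ~ T f, derivable R T `<=` T &
        forall a b, T (Or a b) -> T a \/ T b].
Proof.
move=> pcp nGf.
(* Zorn's lemma is applied to the part added to [G], so that the union of the empty chain is
   admissible. *)
have [|X [nX maxX]] := @Zorn_bigcup _ [set X | ~ derivable R (G `|` X) f].
  move=> F FP Ftot /=.
  have [F0|/set0P F0] := eqVneq F set0.
    by rewrite F0 bigcup_set0 setU0.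
  by move=> /(derivable_chain F0 Ftot)[Y /FP].
pose T := G `|` X; rewrite /= -/T in nX.
have add g : ~ T g -> derivable R (T `|` [set g]) f.
  move=> nTg; apply: contrapT; rewrite /T -setUA; apply: maxX.
  by split=> [h Xh|XgX]; [left|apply: nTg; right; apply: XgX; right].
exists T; split=> [||g Tg|a b Tab]; first by move=> g; left.
- by move=> Tf; apply: nX; exact: derivable_hyp.
- by apply: contrapT => /add /(derivable_cut1 Tg).
- apply: contrapT => /not_orP[/add Ha /add Hb]; apply: nX.
  exact: derivable_cut1 (derivable_hyp _ Tab) (pcp _ _ _ _ Ha Hb).
Qed.

End Derivability.

(** * Inequalities of De Morgan lattices as rules *)

(** The side conjunct [c] makes the laws applicable inside the contexts that test the Leibniz
    congruence. *)
Definition bd_eqns (a b c : formula) : seq (formula * formula) :=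
  [:: (And (And a b) c, And a (And b c)); (And (And a b) c, And b (And a c));
      (And (Or a b) c, Or (And a c) (And b c));
      (And (Not (And a b)) c, Or (And (Not a) c) (And (Not b) c));
      (And (Not (Or a b)) c, And (Not a) (And (Not b) c));
      (And (Not (Or a b)) c, And (Not b) (And (Not a) c));
      (And (Not (Not a)) c, And a c);
      (Or (Or a b) c, Or a (Or b c)); (Or a b, Or b a); (Or a a, a);
      (And a a, a)].

Definition bd_ineqs (a b c : formula) : seq (formula * formula) :=
  [:: (And a b, a), (a, Or a b) &
      bd_eqns a b c ++ [seq (e.2, e.1) | e <- bd_eqns a b c]].

Ltac bd_mem := by rewrite !in_cons eqxx ?orbT.

Definition bd_rules : set rule :=
  [set Rule [set e.1] e.2 |
     e in [set` bd_ineqs (Var 0) (Var 1) (Var 2)]].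

Lemma finite_bd_rules : finite_set bd_rules.
Proof. by apply: finite_image; apply/finite_seqP; eexists. Qed.

Lemma bd_ineqs_subst s a b c :
  bd_ineqs (subst s a) (subst s b) (subst s c) =
  [seq (subst s e.1, subst s e.2) | e <- bd_ineqs a b c].
Proof. by []. Qed.

Lemma derivable_bd (R : set rule) (G : set formula) a b c p q :
  bd_rules `<=` R -> (p, q) \in bd_ineqs a b c ->
  derivable R G p -> derivable R G q.
Proof.
(* The default value of [nth] sends [Var 2] to [c]. *)
move=> bdR; pose s := nth c [:: a; b].
rewrite -[bd_ineqs a b c]/(bd_ineqs (subst s (Var 0)) (subst s (Var 1)) (subst s (Var 2))).
rewrite bd_ineqs_subst => /mapP[e eE [-> ->]] Gp.
have Re : R (Rule [set e.1] e.2) by apply: bdR; exists e.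
by apply: (derivable_subst_rule Re) => _ ->.
Qed.

Section DeMorganLattice.
Variables (A : algebra) (dmA : is_deMorgan_lattice A).

Lemma dm_meetxx (x : A) : meet x x = x.
Proof. by rewrite -{2}(dm_meetKU dmA x x) (dm_joinKI dmA). Qed.

Lemma dm_joinxx (x : A) : join x x = x.
Proof. by rewrite -{2}(dm_joinKI dmA x x) (dm_meetKU dmA). Qed.

Lemma bd_eqns_sound (v : nat -> A) a b c e :
  e \in bd_eqns a b c -> ext v e.1 = ext v e.2.
Proof.
have [[[mC jC] mA] jA] := (dm_meetC dmA, dm_joinC dmA, dm_meetA dmA, dm_joinA dmA).
rewrite !in_cons; do 11?[case/predU1P=> [-> /=|]] => //.
all: rewrite ?(dm_negI dmA) ?(dm_negU dmA) ?(dm_negK dmA) ?(dm_meetUl dmA) //.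
all: rewrite ?dm_meetxx ?dm_joinxx //.
all: by rewrite ?mA ?jA //; try (by rewrite jC); congr meet; rewrite mC.
Qed.

Lemma bd_ineqs_sound (v : nat -> A) a b c e :
  e \in bd_ineqs a b c -> lat_le (ext v e.1) (ext v e.2).
Proof.
rewrite 2!in_cons mem_cat => /or3P[/eqP->|/eqP->|/orP[|/mapP[e' + ->]]] /=.
- by rewrite /lat_le -(dm_meetA dmA) (dm_meetC dmA (ext v b)) (dm_meetA dmA) dm_meetxx.
- exact: dm_joinKI.
- by move=> /(bd_eqns_sound v) ->; exact: dm_meetxx.
- by move=> /(bd_eqns_sound v) ->; exact: dm_meetxx.
Qed.

End DeMorganLattice.

Lemma BDinfty_bd a b c p q :
  (p, q) \in bd_ineqs a b c -> BDinfty [set p] q.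
Proof.
move=> pq M [dmM upM] v hv Mp /=.
rewrite (hom_ext hv); apply: upM (bd_ineqs_sound dmM _ pq) _ => /=.
by rewrite -(hom_ext hv); apply: Mp; exists p.
Qed.

(** * Rules with a disjunctive side formula *)

Definition shift : formula -> formula := subst (fun n => Var n.+1).

(** The shift frees [Var 0] for the side formula. *)
Definition lift_rule (r : rule) : rule :=
  Rule [set Or (shift p) (Var 0) | p in premises r]
       (Or (shift (conclusion r)) (Var 0)).

Definition lift_closure (R : set rule) : set rule := R `|` lift_rule @` R.

Definition scons (b : formula) (s : nat -> formula) (n : nat) : formula :=
  if n is m.+1 then s m else b.

Lemma subst_shift b s f : subst (scons b s) (shift f) = subst s f.
Proof. by rewrite subst_subst. Qed.

Lemma lift_closure_finite (R : set rule) :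
  finite_set R -> finite_set (lift_closure R).
Proof. by move=> finR; rewrite finite_setU; split=> //; exact: finite_image. Qed.

Lemma lift_closure_finitary (R : set rule) :
  R `<=` finitary -> lift_closure R `<=` finitary.
Proof.
by move=> Rfin r [/Rfin//|[r' /Rfin ? <-]]; exact: finite_image.
Qed.

Section LiftClosure.
Variables (R0 : set rule) (bdR0 : bd_rules `<=` R0).
Let R := lift_closure R0.

Let bdR : bd_rules `<=` R.
Proof. by move=> r /bdR0; left. Qed.

Lemma derivable_lift (G : set formula) r s b : R0 r ->
  (forall p, premises r p -> derivable R G (Or (subst s p) b)) ->
  derivable R G (Or (subst s (conclusion r)) b).
Proof.
move=> R0r Hp; have Rr : R (lift_rule r) by right; exists r.
rewrite -(subst_shift b); apply: (derivable_subst_rule (s := scons b s) Rr).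
move=> _ [p rp <-].
by have := Hp p rp; rewrite -(subst_shift b).
Qed.

(** Induction on the derivation, each step with a rule of [R0] being replaced by its lifted form. *)
Lemma derivable_Or_hyp (G : set formula) a b g :
  derivable R (G `|` [set a]) g ->
  derivable R (G `|` [set Or a b]) (Or g b).
Proof.
elim=> [h [Gh|->]|r s Rr hs _ IH].
- apply: (@derivable_bd _ _ h b b h) => //; first bd_mem.
  by apply: derivable_hyp; left.
- by apply: derivable_hyp; right.
rewrite (hom_ext hs); set t := fun n => s (Var n).
have {}IH p : premises r p ->
    derivable R (G `|` [set Or a b]) (Or (subst t p) b).
  by move=> /IH; rewrite (hom_ext hs).
case: Rr IH => [R0r|[r0 R0r <-]] IH; first exact: derivable_lift.
(* A lifted rule with side formula [d] needs no second lifting: by associativity it is applied with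
   side formula [Or d b]. *)
set d := t 0; set u := fun n => t n.+1.
have liftE p : subst t (Or (shift p) (Var 0)) = Or (subst u p) d.
  by rewrite -(subst_shift d u) /subst /=; congr Or; apply: (@eq_ext formula_algebra) => -[].
rewrite -[ext _ _]/(subst t (Or (shift (conclusion r0)) (Var 0))) liftE.
apply: (@derivable_bd _ _ (subst u (conclusion r0)) d b
          (Or (subst u (conclusion r0)) (Or d b))) => //; first bd_mem.
apply: derivable_lift => // p rp.
apply: (@derivable_bd _ _ (subst u p) d b (Or (Or (subst u p) d) b)) => //.
  bd_mem.
by rewrite -liftE; apply: IH; exists p.
Qed.

Lemma PCP_lift_closure : PCP (derivable R).
Proof.
(* [Or a b] gives [Or g b], hence [Or b g], which gives [Or g g] and so [g]. *)
move=> G a b g Ha Hb; have Hab := derivable_Or_hyp b Ha.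
have Hbg := derivable_Or_hyp g Hb.
apply: (@derivable_bd _ _ g g g (Or g g)) => //; first bd_mem.
apply: derivable_cut Hbg => d [Gd|->]; first by apply: derivable_hyp; left.
by apply: (@derivable_bd _ _ g b b (Or g b)) => //; bd_mem.
Qed.

End LiftClosure.

Section LogicWithPCP.
Variables (L : consequence) (Llog : is_logic L) (LBD : extends L BDinfty).
Hypothesis Lpcp : PCP L.

Lemma L_bd a b c p q (G : set formula) :
  (p, q) \in bd_ineqs a b c -> L G p -> L G q.
Proof.
move=> /BDinfty_bd/LBD pq Gp; apply: (logic_cut Llog) pq => _ -> //.
Qed.

(** The PCP weakens the premises one at a time; the case of the other disjunct is settled by
    [bg]. *)
Lemma L_PCP_seq (G : set formula) (l : seq formula) g b :
  L [set b] g -> L (G `|` [set` l]) g ->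
  L (G `|` [set Or p b | p in [set` l]]) g.
Proof.
move=> bg; elim: l G => [|p l IHl] G Gl.
  by apply: (logic_mono Llog) Gl => h []; [left|].
apply: (logic_mono Llog) (IHl (G `|` [set Or p b]) _).
  move=> h [[Gh|->]|[q ql <-]]; [by left|right..].
  - by exists p => //=; exact: mem_head.
  - by exists q => //=; rewrite in_cons; apply/orP; right.
apply: (logic_mono Llog) (Lpcp (G := G `|` [set` l]) (f1 := p) (f2 := b) (g := g) _ _).
- move=> h [[Gh|lh]|->]; [by left; left|by right|by left; right].
- apply: (logic_mono Llog) Gl => h [Gh|/=]; first by left; left.
  by rewrite in_cons => /predU1P[->|lh]; [right|left; right].
- by apply: (logic_mono Llog) bg => h ->; right.
Qed.

Lemma L_lift_rule r : finitary r -> L (premises r) (conclusion r) ->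
  L (premises (lift_rule r)) (conclusion (lift_rule r)).
Proof.
move=> rfin /(logic_subst Llog (@ext_is_hom formula_algebra (fun n => Var n.+1))).
rewrite -/shift => Lr /=.
have /finite_seqP[l lE] : finite_set (shift @` premises r) by exact: finite_image.
have -> : [set Or (shift p) (Var 0) | p in premises r] =
          [set Or p (Var 0) | p in shift @` premises r].
  apply/seteqP; split=> [_ [p rp <-]|_ [_ [p rp <-] <-]]; last by exists p.
  by exists (shift p) => //; exists p.
rewrite lE -[X in L X]set0U; apply: L_PCP_seq.
  apply: (@L_bd (Var 0) (shift (conclusion r)) (Var 0)
            (Or (Var 0) (shift (conclusion r)))); first bd_mem.
  apply: (@L_bd (Var 0) (shift (conclusion r)) (Var 0) (Var 0)).
    bd_mem.
  exact: logic_refl.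
rewrite set0U -lE.
by apply: (@L_bd (shift (conclusion r)) (Var 0) (Var 0)
  (shift (conclusion r))) => //; bd_mem.
Qed.

Lemma lift_closure_sound (R : set rule) : R `<=` finitary ->
  (forall r, R r -> L (premises r) (conclusion r)) ->
  forall G f, derivable (lift_closure R) G f -> L G f.
Proof.
move=> Rfin RL; apply: derivable_sound => // r [/RL//|[r' Rr' <-]].
by apply: L_lift_rule; [exact: Rfin|exact: RL].
Qed.

End LogicWithPCP.

(** * The Leibniz congruence of a prime theory *)

Section PrimeTheory.
Variable T : set formula.
Hypothesis Tbd : forall a b c p q, (p, q) \in bd_ineqs a b c -> T p -> T q.
Hypothesis Tprime : forall a b, T (Or a b) -> T a \/ T b.

(* By primeness of [T], membership of a formula [C[a]] in [T] only depends on
   which formulas [a /\ c] and [~ a /\ c] are in [T], so that the kernel of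
   [leibniz] is the Leibniz congruence of [T]. *)
Definition leibniz (a : formula) : set formula * set formula :=
  ([set c | T (And a c)], [set c | T (And (Not a) c)]).

Lemma T_bd_eqn a b c p q : (p, q) \in bd_eqns a b c -> T p = T q.
Proof.
move=> pq; apply/propext; split; apply: (Tbd (a := a) (b := b) (c := c)).
  by rewrite /bd_ineqs 2!in_cons mem_cat pq ?orbT.
rewrite /bd_ineqs 2!in_cons mem_cat; apply/or3P/Or33/orP; right.
by apply/mapP; exists (p, q).
Qed.

Lemma T_Or a b : T (Or a b) = (T a \/ T b).
Proof.
apply/propext; split=> [|[]]; first exact: Tprime.
  by apply: (Tbd (a := a) (b := b) (c := b)); bd_mem.
rewrite (@T_bd_eqn a b b (Or a b) (Or b a)); last bd_mem.
by apply: (Tbd (a := b) (b := a) (c := b)); bd_mem.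
Qed.

Lemma T_AndA a b c : T (And (And a b) c) = T (And a (And b c)).
Proof. by apply: (@T_bd_eqn a b c); bd_mem. Qed.

Lemma T_AndCA a b c : T (And (And a b) c) = T (And b (And a c)).
Proof. by apply: (@T_bd_eqn a b c); bd_mem. Qed.

Lemma T_AndOr a b c : T (And (Or a b) c) = (T (And a c) \/ T (And b c)).
Proof. by rewrite -T_Or; apply: (@T_bd_eqn a b c); bd_mem. Qed.

Lemma T_NotAnd a b c :
  T (And (Not (And a b)) c) = (T (And (Not a) c) \/ T (And (Not b) c)).
Proof. by rewrite -T_Or; apply: (@T_bd_eqn a b c); bd_mem. Qed.

Lemma T_NotOr a b c :
  T (And (Not (Or a b)) c) = T (And (Not a) (And (Not b) c)).
Proof. by apply: (@T_bd_eqn a b c); bd_mem. Qed.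

Lemma T_NotOrC a b c :
  T (And (Not (Or a b)) c) = T (And (Not b) (And (Not a) c)).
Proof. by apply: (@T_bd_eqn a b c); bd_mem. Qed.

Lemma T_NotNot a c : T (And (Not (Not a)) c) = T (And a c).
Proof. by apply: (@T_bd_eqn a a c); bd_mem. Qed.

Lemma leibnizP a b : leibniz a = leibniz b <->
  forall c, T (And a c) = T (And b c) /\ T (And (Not a) c) = T (And (Not b) c).
Proof.
split=> [[pE nE] c|E].
  by split; [exact: (congr1 (@^~ c) pE)|exact: (congr1 (@^~ c) nE)].
by congr pair; apply/funext => c /=; have [] := E c.
Qed.

Lemma leibniz_Not a a' :
  leibniz a = leibniz a' -> leibniz (Not a) = leibniz (Not a').
Proof.
by move=> /leibnizP E; apply/leibnizP => c; have [pE nE] := E c; rewrite !T_NotNot.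
Qed.

(** Each factor is moved to the front while the other joins the context; a negated meet splits by
    primeness. For [Or] the two halves change roles. *)
Lemma leibniz_And a a' b b' : leibniz a = leibniz a' ->
  leibniz b = leibniz b' -> leibniz (And a b) = leibniz (And a' b').
Proof.
move=> /leibnizP Ea /leibnizP Eb; apply/leibnizP => c; split.
  by rewrite T_AndA (Ea _).1 -T_AndA T_AndCA (Eb _).1 -T_AndCA.
by rewrite !T_NotAnd (Ea c).2 (Eb c).2.
Qed.

Lemma leibniz_Or a a' b b' : leibniz a = leibniz a' ->
  leibniz b = leibniz b' -> leibniz (Or a b) = leibniz (Or a' b').
Proof.
move=> /leibnizP Ea /leibnizP Eb; apply/leibnizP => c; split.
  by rewrite !T_AndOr (Ea c).1 (Eb c).1.
by rewrite T_NotOr (Ea _).2 -T_NotOr T_NotOrC (Eb _).2 -T_NotOrC.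
Qed.

Lemma leibniz_mem a b : leibniz a = leibniz b -> T a -> T b.
Proof.
(* The test context is [a] itself: from [And a a] to [And b a], and then to [b]. *)
move=> /leibnizP/(_ a)[E _] Ta.
have : T (And a a) by rewrite (@T_bd_eqn a a a _ a) //; bd_mem.
rewrite E.
by apply: (Tbd (a := b) (b := a) (c := a)); bd_mem.
Qed.

End PrimeTheory.

(** A longest duplicate-free list of values of [f] has at most [n.+1] entries and, by maximality,
    contains every value. Positions in it give [c], listed preimages give [r]. *)
Lemma bounded_image_classifier (U : Type) (X : eqType) (u0 : U) (f : U -> X) n :
  (forall a : 'I_n.+2 -> U, exists i j, i != j /\ f (a i) = f (a j)) ->
  exists (c : U -> 'I_n.+1) (r : 'I_n.+1 -> U),
    (forall x, f (r (c x)) = f x) /\ (forall x y, f x = f y -> c x = c y).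
Proof.
move=> fcoll.
pose P m := `[<exists2 s : seq U, size s = m & uniq (map f s)>].
have P0 : exists m, P m by exists 0; apply/asboolP; exists [::].
have Pn m : P m -> m <= n.+1.
  move=> /asboolP[s <- us]; rewrite leqNgt; apply/negP => ns.
  have [i [j [/eqP ij]]] := fcoll (fun i : 'I_n.+2 => nth u0 s i).
  have lts (k : 'I_n.+2) : k < size s by exact: leq_trans (ltn_ord k) ns.
  rewrite -!(nth_map _ (f u0)) // => /eqP; rewrite nth_uniq ?size_map //.
  by move=> /eqP/val_inj.
case: (ex_maxnP P0 Pn) => m /asboolP[s sm us] maxm.
have fs x : f x \in map f s.
  apply: contraT => nx.
  suff /maxm : P m.+1 by rewrite ltnn.
  by apply/asboolP; exists (x :: s); rewrite /= ?sm ?nx.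
have idx x : index (f x) (map f s) < size s by rewrite -(size_map f) index_mem.
have sn : size s <= n.+1 by rewrite sm; apply: Pn; apply/asboolP; exists s.
exists (fun x => inord (index (f x) (map f s))), (fun i => nth u0 s i).
split=> [x|x y ->] //.
rewrite inordK; last exact: leq_trans (idx x) sn.
by rewrite -(nth_map _ (f u0)) // nth_index.
Qed.

(** * Generating structures as operation tables *)

Definition table (N : nat) : finType :=
  ({ffun 'I_N.+1 * 'I_N.+1 -> 'I_N.+1} * {ffun 'I_N.+1 * 'I_N.+1 -> 'I_N.+1} *
   {ffun 'I_N.+1 -> 'I_N.+1} * {set 'I_N.+1})%type.

(* Universe constraints forbid ['I_N.+1] as the carrier of an [algebra], hence
   this copy of it in [Set]. *)
Definition code (N : nat) : Set := {n : nat | n < N.+1}.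

Definition code_of N (i : 'I_N.+1) : code N := exist _ (val i) (ltn_ord i).

Definition ord_of N (x : code N) : 'I_N.+1 := Ordinal (proj2_sig x).

Lemma ord_ofK N : cancel (@ord_of N) (@code_of N).
Proof. by move=> [n ltn]; congr exist; exact: bool_irrelevance. Qed.

Lemma code_ofK N : cancel (@code_of N) (@ord_of N).
Proof. by move=> i; exact: val_inj. Qed.

Definition table_algebra N (b : table N) : algebra :=
  @Algebra (code N) (fun x y => code_of (b.1.1.1 (ord_of x, ord_of y)))
    (fun x y => code_of (b.1.1.2 (ord_of x, ord_of y)))
    (fun x => code_of (b.1.2 (ord_of x))).

Definition table_structure N (b : table N) : structure :=
  @Structure (table_algebra b) [set x | ord_of x \in b.2].

(** Used twice: to code a small structure, where [h] undoes [g], and for a quotient of the formula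
    algebra, where [h (g x)] is only Leibniz congruent to [x]. *)
Lemma table_of_section N (M : structure) (h : 'I_N.+1 -> M) (g : M -> 'I_N.+1) :
  exists b : table N,
    [/\ forall x y : table_algebra b,
          meet x y = code_of (g (meet (h (ord_of x)) (h (ord_of y)))),
        forall x y : table_algebra b,
          join x y = code_of (g (join (h (ord_of x)) (h (ord_of y)))),
        forall x : table_algebra b, neg x = code_of (g (neg (h (ord_of x)))) &
        forall x, @designated (table_structure b) x <->
          @designated M (h (ord_of x))].
Proof.
exists ([ffun p => g (meet (h p.1) (h p.2))], [ffun p => g (join (h p.1) (h p.2))],
  [ffun x => g (neg (h x))], finset (fun x => `[<designated (h x)>])).
split=> [x y|x y|x|x] /=; rewrite ?ffunE //.
by rewrite inE; split=> /asboolP.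
Qed.

Definition models (L : consequence) : set structure :=
  [set M | forall G f, L G f -> valid M (Rule G f)].

Lemma finite_set_bound (T : Type) (A : set T) (m : T -> nat) :
  finite_set A -> exists N, forall x, A x -> m x <= N.
Proof.
move=> /(@finite_seqP {classic T})[s As].
exists (\max_(x <- s) m x) => x; rewrite As /= => xs.
exact: (@leq_bigmax_seq {classic T}).
Qed.

(** Generating structures are padded to a common size: the table is mapped onto [M] by the strict
    homomorphism [h], so both validate the same rules. *)
Lemma finitely_generated_tables (L : consequence) : finitely_generated L ->
  exists N, forall (G : set formula) f,
    (forall b : table N, models L (table_structure b) ->
       valid (table_structure b) (Rule G f)) -> L G f.
Proof.
move=> [K [Kfin Kfs LK]].
have /choice[m mP] : forall M : structure, exists n,
    K M -> exists2 s : seq {classic M}, size s = n & forall x, x \in s.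
  move=> M; have [/Kfs/(@finite_seqP {classic M})[s sE]|nK] := pselect (K M).
    by exists (size s) => _; exists s => // x; have : [set: {classic M}] x by []; rewrite sE.
  by exists 0.
have [N NP] := finite_set_bound m Kfin.
exists N => G f Lb; apply/LK => M KM v hv vG.
(* Indices past the end of [e] become copies of the default element [x0]. *)
have [e em eP] := mP M KM; pose x0 := v (Var 0).
pose h (i : 'I_N.+1) : M := nth x0 e i.
pose g (x : M) : 'I_N.+1 := inord (index (x : {classic M}) e).
have gK : cancel g h.
  move=> x; rewrite /h /g inordK.
    by rewrite (@nth_index {classic M}) //; exact: eP.
  rewrite ltnS; apply: leq_trans (NP M KM); rewrite -em; apply: ltnW.
  by rewrite index_mem; exact: eP.
have [b [bI bU bN bF]] := table_of_section h g.
have hb (w : formula -> table_algebra b) :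
    @is_hom formula_algebra _ w -> @is_hom formula_algebra M (h \o @ord_of N \o w).
  move=> [wI wU wN]; split=> [x y|x y|x] /=.
  - by rewrite [w _]wI bI code_ofK gK.
  - by rewrite [w _]wU bU code_ofK gK.
  - by rewrite [w _]wN bN code_ofK gK.
have bL : models L (table_structure b).
  move=> D k /LK/(_ M KM) MDk w hw wD; apply/bF; apply: (MDk _ (hb _ hw)).
  by move=> _ [d Dd <-]; apply/bF; apply: wD; exists d.
pose w : formula -> table_algebra b := ext (fun n => code_of (g (v (Var n))) : table_algebra b).
have hw : @is_hom formula_algebra _ w := ext_is_hom _.
have wv x : h (ord_of (w x)) = v x.
  rewrite -[h _]/((h \o @ord_of N \o w) x) (hom_ext (hb _ hw)) (hom_ext hv).
  by apply: eq_ext => n /=; rewrite code_ofK gK.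
rewrite -wv; apply/bF; apply: (Lb b bL w hw) => _ [d Gd <-].
by apply/bF; rewrite wv; apply: vG; exists d.
Qed.

(** * Bounding the number of Leibniz classes by rules *)

Section Separation.
Variable N : nat.

(* A family of [N + 2] formulas together with one parameter for each pair. *)
Let family := ('I_N.+2 + 'I_N.+2 * 'I_N.+2)%type.

(* [o p] records how the pair [p] is separated: whether after negation, and in
   which direction.  The literal of [p] at [d = true] is to be in the theory,
   the one at [d = false] is not. *)
Definition separator (o : 'I_N.+2 * 'I_N.+2 -> bool * bool)
    (w : family -> formula) (d : bool) (p : 'I_N.+2 * 'I_N.+2) : formula :=
  let a := w (inl (if (o p).2 == d then p.1 else p.2)) in
  And (if (o p).1 then Not a else a) (w (inr p)).

Definition offdiag : seq ('I_N.+2 * 'I_N.+2) :=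
  enum [pred p : 'I_N.+2 * 'I_N.+2 | p.1 != p.2].

(** Formulas have no constant for falsum, so the disjunct [f] closes the list. *)
Definition bigOr (f : formula) (l : seq formula) : formula := foldr Or f l.

(** The closing pair [(ord0, ord_max)] is off the diagonal, since there are at least two indices. *)
Definition separation_rule (o : {ffun 'I_N.+2 * 'I_N.+2 -> bool * bool}) : rule :=
  let w z := Var (pickle (z : family)) in
  Rule [set separator o w true p | p in [set` offdiag]]
       (bigOr (separator o w false (ord0, ord_max))
          [seq separator o w false p | p <- offdiag]).

Definition separation_rules : set rule := range separation_rule.

Lemma finite_separation_rules : finite_set separation_rules.
Proof. by apply: finite_image; exact: finite_finset. Qed.

Lemma separation_rules_finitary : separation_rules `<=` finitary.
Proof.
by move=> _ [o _ <-]; apply: finite_image; exact: finite_finset.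
Qed.

Lemma mem_offdiag p : (p \in offdiag) = (p.1 != p.2).
Proof. by rewrite mem_enum. Qed.

Lemma subst_bigOr s f l : subst s (bigOr f l) = bigOr (subst s f) (map (subst s) l).
Proof. by elim: l => //= g l <-. Qed.

(** Pigeonhole: two of the [N.+2] formulas get the same value in a table with [N.+1] elements, so
    both literals of that pair have the same value. *)
Lemma separation_rule_sound (L : consequence) o (G := premises (separation_rule o)) :
  is_logic L -> extends L BDinfty ->
  (forall (G : set formula) f,
    (forall b : table N, models L (table_structure b) ->
       valid (table_structure b) (Rule G f)) -> L G f) ->
  L G (conclusion (separation_rule o)).
Proof.
move=> Llog LBD Ltab; apply: Ltab => b bL v hv vG.
rewrite /separation_rule /=; set w := fun z => Var _.
have [i [j [ij eqij]]] : exists i j : 'I_N.+2,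
    i != j /\ v (w (inl i)) = v (w (inl j)).
  have /injectivePn[i [j ij eqij]] :
      ~~ injectiveb (fun i : 'I_N.+2 => ord_of (v (w (inl i)))).
    apply/negP => /injectiveP/leq_card; rewrite !card_ord ltnn //.
  by exists i, j; split=> //; exact: can_inj (@ord_ofK N) _ _ eqij.
pose p := (i, j); have pO : p \in offdiag by rewrite mem_offdiag.
have [hI _ hN] := hv.
have : @designated (table_structure b) (v (separator o w false p)).
  have -> : v (separator o w false p) = v (separator o w true p).
    rewrite /separator [LHS]hI [RHS]hI; congr meet.
    by case: (o p) => [[] []] /=; rewrite ?eqij // [LHS]hN [RHS]hN eqij.
  by apply: vG; exists (separator o w true p) => //; exists p.
(* The table is only known to be a model of [L], so the passage from a disjunct to the disjunction
   goes through [L]. *)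
have : L [set separator o w false p] (bigOr (separator o w false (ord0, ord_max))
    [seq separator o w false q | q <- offdiag]).
  have : separator o w false p \in [seq separator o w false q | q <- offdiag].
    exact: map_f.
  move: [seq _ | _ <- _] => l; elim: l => //= f l IHl.
  rewrite in_cons => /predU1P[->|/IHl {}IHl].
    apply: (@L_bd _ Llog LBD f (bigOr (separator o w false (ord0, ord_max)) l) f f).
      bd_mem.
    exact: logic_refl.
  set g := bigOr _ _ in IHl *.
  apply: (@L_bd _ Llog LBD g f f (Or g f)); first bd_mem.
  by apply: (@L_bd _ Llog LBD g f f g) => //; bd_mem.
move=> /bL/(_ v hv) vL vp; apply: vL => _ [_ -> <-]; exact: vp.
Qed.

Lemma prime_theory_bounded (R : set rule) (T : set formula) :
  separation_rules `<=` R -> derivable R T `<=` T ->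
  (forall a b, T (Or a b) -> T a \/ T b) ->
  forall a : 'I_N.+2 -> formula,
    exists i j, i != j /\ leibniz T (a i) = leibniz T (a j).
Proof.
move=> sepR Tclosed Tprime a; apply: contrapT => nsep.
(* [co p] is the parameter and the orientation separating the pair. The claim is made for every
   suitable [w], as the actual [w] is assembled from all these choices. *)
have /choice[co coP] : forall p : 'I_N.+2 * 'I_N.+2, exists co : formula * (bool * bool),
    p.1 != p.2 -> forall w : family -> formula,
    (forall i, w (inl i) = a i) -> w (inr p) = co.1 ->
    T (separator (fun=> co.2) w true p) /\ ~ T (separator (fun=> co.2) w false p).
  move=> [i j] /=; have [<-|ij] := eqVneq i j; first by exists (Var 0, (true, true)).
  apply: contrapT => nco; apply: nsep; exists i, j; split=> //.
  have {}nco c s (d : bool) (f := fun k => And (if s then Not (a k) else a k) c) :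
      T (f (if d then i else j)) -> T (f (if d then j else i)).
    move=> Tf; apply: contrapT => nTf; apply: nco.
    exists (c, (s, d)) => _ w wa /= wc; rewrite /separator /= !wa wc.
    by case: d Tf nTf.
  apply/leibnizP => c; split; apply/propext; split.
  - exact: (nco c false true).
  - exact: (nco c false false).
  - exact: (nco c true true).
  - exact: (nco c true false).
pose o := [ffun p => (co p).2].
pose w (z : family) := match z with inl i => a i | inr p => (co p).1 end.
have sepE d p : separator o w d p = separator (fun=> (co p).2) w d p.
  by rewrite /separator ffunE.
pose s n := if unpickle n is Some z then w z else Var 0.
have sw z : subst s (Var (pickle z)) = w z by rewrite /subst /= /s pickleK.
have sE d p : subst s (separator o (fun z => Var (pickle z)) d p) = separator o w d p.
  by rewrite /separator; case: (o p) => s1 s2; rewrite -(sw (inr p)) -sw; case: s1.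
have : T (subst s (conclusion (separation_rule o))).
  apply: Tclosed; apply: derivable_subst_rule; first by apply: sepR; exists o.
  move=> _ [p /= pO <-]; apply: derivable_hyp; rewrite sE sepE.
  by have [] := coP p _ w (fun=> erefl) erefl; rewrite -?mem_offdiag.
rewrite /= subst_bigOr sE -map_comp.
have nT p : p.1 != p.2 -> ~ T (separator o w false p).
  by move=> pO; rewrite sepE; have [] := coP p pO w (fun=> erefl) erefl.
have : {subset offdiag <= [pred p | p.1 != p.2]} by move=> p; rewrite mem_offdiag.
elim: offdiag => [|p l IHl] sub /=; first exact: nT.
move=> /Tprime[|]; first by rewrite sE; apply: nT; exact: sub (mem_head _ _).
by apply: IHl => q ql; apply: sub; rewrite in_cons ql orbT.
Qed.

End Separation.

(** * Rules between representatives of the formulas in finitely many variables *)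

Section Representatives.
Variable N : nat.

Let tuple_values := {ffun table N * {ffun 'I_N.+1 -> 'I_N.+1} -> 'I_N.+1}.

(** Variables beyond [N] are read as variable 0, the default of [inord]. *)
Definition truth_table (f : formula) : tuple_values :=
  [ffun p : table N * {ffun 'I_N.+1 -> 'I_N.+1} =>
     ord_of (@ext (table_algebra p.1) (fun n => code_of (p.2 (inord n))) f)].

(** Formulas with equal truth tables agree in every table; [E] picks one of them and renames its
    variables into the first [N.+1]. *)
Lemma exists_representative :
  exists E : tuple_values -> formula,
    forall (b : table N) (v : nat -> table_algebra b) f,
      ext v (E (truth_table f)) = ext (fun n => v (inord n : 'I_N.+1)) f.
Proof.
have /choice[r rP] : forall x, exists g, forall f, truth_table f = x -> truth_table g = x.
  move=> x; have [[g gx]|nx] := pselect (exists g, truth_table g = x).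
    by exists g.
  by exists (Var 0) => f fx; case: nx; exists f.
exists (fun x => subst (fun n => Var (inord n : 'I_N.+1)) (r x)) => b v f.
rewrite ext_subst /=; apply: (can_inj (@ord_ofK N)).
pose u : {ffun 'I_N.+1 -> 'I_N.+1} := [ffun i : 'I_N.+1 => ord_of (v i)].
have uE g : ord_of (ext (fun n => v (inord n : 'I_N.+1)) g) = truth_table g (b, u).
  rewrite ffunE /=; congr ord_of; apply: (@eq_ext (table_algebra b)) => n.
  by rewrite ffunE ord_ofK.
by rewrite !uE (rP _ f).
Qed.

Definition representative_rules (L : consequence) (E : tuple_values -> formula) :
    set rule :=
  [set r | L (premises r) (conclusion r)] `&`
  [set Rule (E @` [set` p.1]) (E p.2) | p in [set: {set tuple_values} * tuple_values]].

Lemma finite_representative_rules L E : finite_set (representative_rules L E).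
Proof.
apply: (sub_finite_set (@subIsetr _ _ _)).
by apply: finite_image; exact: finite_finset.
Qed.

Lemma representative_rules_finitary L E : representative_rules L E `<=` finitary.
Proof.
by move=> _ [_ [p _ <-]]; apply: finite_image; exact: finite_finset.
Qed.

End Representatives.

(** * Completeness of the finite Hilbert system *)

Section FiniteAxiomatization.
Variables (L : consequence) (N : nat).
Hypotheses (Llog : is_logic L) (LBD : extends L BDinfty) (Lpcp : PCP L).
Hypothesis Ltab : forall (G : set formula) f,
  (forall b : table N, models L (table_structure b) ->
     valid (table_structure b) (Rule G f)) -> L G f.

(** In every table [F g] has the value of [g] with variables identified along [s]. This turns a
    possibly infinite premise set into a finite one. *)
Lemma L_representatives E (s : nat -> 'I_N.+1)
    (F := fun f => E (truth_table N (subst (fun n => Var (s n)) f))) :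
  (forall (b : table N) (v : nat -> table_algebra b) f,
    ext v (E (truth_table N f)) = ext (fun n => v (inord n : 'I_N.+1)) f) ->
  forall (G : set formula) f, L G f -> L (F @` G) (F f).
Proof.
move=> EP G f Gf; apply: Ltab => b /(_ _ _ Gf) bGf v hv vFG.
pose u n := v (Var (s n)).
have FE g : v (F g) = ext u g.
  rewrite (hom_ext hv) /F EP ext_subst; apply: eq_ext => n /=.
  by rewrite inord_val.
rewrite FE; apply: (bGf _ (ext_is_hom u)) => _ [g Gg <-].
by rewrite -FE; apply: vFG; exists (F g) => //; exists g.
Qed.

(** Each formula is Leibniz congruent to an instance of its representative, so an entailment of [L]
    reduces to a representative rule, under which [T] is closed. *)
Lemma prime_theory_L_closed (R : set rule) (T : set formula) E :
  (forall (b : table N) (v : nat -> table_algebra b) f,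
    ext v (E (truth_table N f)) = ext (fun n => v (inord n : 'I_N.+1)) f) ->
  bd_rules `|` separation_rules N `|` representative_rules L E `<=` R ->
  derivable R T `<=` T -> (forall a b, T (Or a b) -> T a \/ T b) ->
  forall (G : set formula) f, G `<=` T -> L G f -> T f.
Proof.
move=> EP subR Tclosed Tprime G f GT Gf.
have Tbd a b c p q : (p, q) \in bd_ineqs a b c -> T p -> T q.
  move=> pq Tp; apply: Tclosed.
  apply: derivable_bd pq (derivable_hyp _ Tp).
  by move=> r bdr; apply: subR; left; left.
have sepR : separation_rules N `<=` R.
  by move=> r sr; apply: subR; left; right.
have [c [r [cK cE]]] := bounded_image_classifier (Var 0)
  (prime_theory_bounded sepR Tclosed Tprime).
(* Operations are computed on the class representatives [r], which makes [c] a homomorphism with the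
   Leibniz congruence as kernel; [set0] is a dummy. *)
have [b [bI bU bN _]] := @table_of_section N
  (@Structure formula_algebra set0) r c.
have homc : @is_hom formula_algebra (table_algebra b) (@code_of N \o c).
  split=> [x y|x y|x].
  - rewrite [RHS]bI /= !code_ofK; congr code_of; apply: cE.
    by apply: (leibniz_And Tbd) => //; rewrite cK.
  - rewrite [RHS]bU /= !code_ofK; congr code_of; apply: cE.
    by apply: (leibniz_Or Tbd) => //; rewrite cK.
  - rewrite [RHS]bN /= !code_ofK; congr code_of; apply: cE.
    by apply: (leibniz_Not Tbd) => //; rewrite cK.
pose s n := c (Var n).
(* [t] replaces the variable of a class by the chosen formula of that class. *)
pose t n := r (inord n).
pose F g := truth_table N (subst (fun n => Var (s n)) g).
(* The class of [g] is its value in the quotient table [b], and [E (F g)] has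
   the same value there as [g] with its variables renamed to their classes. *)
have FE g : leibniz T (subst t (E (F g))) = leibniz T g.
  suff cFE : c (subst t (E (F g))) = c g by rewrite -cK cFE cK.
  apply: (can_inj (@code_ofK N)).
  have cx x : code_of (c x) = ext (A := table_algebra b) (fun n => code_of (s n)) x.
    exact: (hom_ext homc x).
  rewrite !cx ext_subst EP ext_subst; apply: (@eq_ext (table_algebra b)) => n /=.
  rewrite !inord_val -cx /t inord_val; congr code_of; exact/cE/cK.
pose A := finset (fun x => `[<exists2 g, G g & F g = x>]).
have Rr : R (Rule (E @` [set` A]) (E (F f))).
  apply: subR; right; split; last by exists (A, F f).
  apply: (logic_mono Llog) (@L_representatives E s EP G f Gf).
  move=> _ [g Gg <-]; exists (F g) => //=.
  by rewrite inE; apply/asboolP; exists g.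
apply: (leibniz_mem Tbd) (FE f) _; apply: Tclosed.
apply: (derivable_subst_rule Rr) => _ [x /= + <-].
rewrite inE => /asboolP[g Gg <-]; apply: derivable_hyp.
by apply: (leibniz_mem Tbd) (esym (FE g)) _; exact: GT.
Qed.

Lemma finite_axiomatization_of_tables : has_finite_Hilbert_axiomatization L.
Proof.
have [E EP] := exists_representative N.
pose R0 := bd_rules `|` separation_rules N `|` representative_rules L E.
have R0fin : R0 `<=` finitary.
  move=> r [[[e _ <-]|/separation_rules_finitary//]|].
    exact: finite_set1.
  exact: representative_rules_finitary.
exists (lift_closure R0); split.
- apply: lift_closure_finite; rewrite !finite_setU; split; [split|].
  + exact: finite_bd_rules.
  + exact: finite_separation_rules.
  + exact: finite_representative_rules.
- exact: lift_closure_finitary.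
move=> G f; split; last first.
  apply: lift_closure_sound => // r [[[[p q] pq <-]|[o _ <-]]|[]//].
    by apply: LBD; exact: BDinfty_bd pq.
  exact: separation_rule_sound.
(* Otherwise a prime theory contains [G] and omits [f], although it is closed under [L]. *)
move=> Gf; apply: contrapT => nGf.
have bdR0 : bd_rules `<=` R0 by move=> r; left; left.
have [T [GT nTf Tclosed Tprime]] :=
  prime_extension (lift_closure_finitary R0fin) (PCP_lift_closure bdR0) nGf.
by apply/nTf/(prime_theory_L_closed EP _ Tclosed Tprime GT Gf) => r; left.
Qed.

End FiniteAxiomatization.

Theorem mainTheorem13 (L : consequence) :
  is_logic L ->
  extends L BDinfty ->
  finitely_generated L ->
  PCP L ->
  has_finite_Hilbert_axiomatization L.
Proof.
move=> Llog LBD /finitely_generated_tables[N Ltab] Lpcp.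
exact: finite_axiomatization_of_tables Ltab.
Qed.
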